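(* If $\mathcal{N}$ is an entanglement-breaking quantum channel, then $$\mathcal{CV}(\mathcal{N})=\log_2\mathrm{cv}(\mathcal{N}),$$ where $\mathcal{CV}(\mathcal{N})=\lim_{k\to\infty}\frac1k\log_2\mathrm{cv}(\mathcal{N}^{\otimes k})$ is the cv capacity.
   Context: All Hilbert spaces are finite-dimensional; a quantum channel is a CPTP map. A channel $\mathcal{N}$ from $A$ to $B$ is entanglement-breaking if $(\mathcal{N}\otimes\mathrm{id}^C)(\rho^{AC})$ is a separable operator on $\mathcal{H}^B\otimes\mathcal{H}^C$ (a non-negative combination of products of pure states) for every system $C$ and every positive semidefinite $\rho^{AC}$. Communication value: for a classical channel with transition probabilities $P(y|x)$, $x\in[n]$, $y\in[n']$, put $\mathrm{cv}(\mathbf{P})=\sum_{y\in[n']}\max_{x\in[n]}P(y|x)$. For a quantum channel, $\mathrm{cv}(\mathcal{N})$ is the supremum, over all $n,n'\in\mathbb{N}$, all density operators $\rho_1,\dots,\rho_n$ on the input space and all POVMs $\{\Pi_y\}_{y=1}^{n'}$ on the output space, of $\mathrm{cv}(\mathbf{P})$ with $P(y|x)=\mathrm{Tr}[\Pi_y\mathcal{N}(\rho_x)]$. *)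

(* Defs.v *)
From HB Require Import structures.
From mathcomp Require Import all_boot all_order all_algebra.
From mathcomp Require Import all_classical all_reals all_analysis.
From mathcomp.real_closed Require Export complex mxtens.

Set Implicit Arguments.
Unset Strict Implicit.
Unset Printing Implicit Defensive.

Import Order.TTheory GRing.Theory Num.Theory.
Import numFieldNormedType.Exports.
Local Open Scope complex_scope.
Local Open Scope sesquilinear_scope.
Local Open Scope ring_scope.

(* A Hilbert space of dimension d is C^d with C := R[i]; operators on it are
   'M[R[i]]_d, a ket is a column vector, and the tensor product of C^m and C^n
   is C^(m * n) with the Kronecker product *t of mxtens. *)

Section States.
Variable R : realType.
Local Notation C := R[i].

(* In R[i], 0 <= z means that z is real and nonnegative, so this entails that
   A is Hermitian. *)
Definition psdmx n (A : 'M[C]_n) : Prop :=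
  forall u : 'cV[C]_n, 0 <= (u ^t* *m A *m u) 0 0.

Definition density n (A : 'M[C]_n) : Prop := psdmx A /\ \tr A = 1.

Definition povm n m (Pi : 'I_m -> 'M[C]_n) : Prop :=
  (forall y, psdmx (Pi y)) /\ \sum_y Pi y = 1%:M.

Definition pure_state n (A : 'M[C]_n) : Prop :=
  exists u : 'cV[C]_n, u ^t* *m u = 1%:M /\ A = u *m u ^t*.

Definition separable b c (X : 'M[C]_(b * c)) : Prop :=
  exists (m : nat) (t : 'I_m -> R) (phi : 'I_m -> 'M[C]_b)
         (psi : 'I_m -> 'M[C]_c),
    [/\ forall i, 0 <= t i,
        forall i, pure_state (phi i),
        forall i, pure_state (psi i)
      & X = \sum_i (t i)%:C *: (phi i *t psi i)].

End States.

Section Channels.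
Variable R : realType.
Local Notation C := R[i].

(* Tensor product of linear maps, expanded on matrix units; it is the linear
   map sending X *t Y to N X *t M Y, see tensopE and tensop_is_linear. *)
Definition tensop a b c d (N : 'M[C]_a -> 'M[C]_b) (M : 'M[C]_c -> 'M[C]_d)
    (Z : 'M[C]_(a * c)) : 'M[C]_(b * d) :=
  \sum_(i < a) \sum_(j < a) \sum_(k < c) \sum_(l < c)
    Z (mxtens_index (i, k)) (mxtens_index (j, l)) *:
      (N (delta_mx i j) *t M (delta_mx k l)).

Lemma tensop_is_linear a b c d (N : 'M[C]_a -> 'M[C]_b)
  (M : 'M[C]_c -> 'M[C]_d) : linear (tensop N M).
Proof.
move=> x U V; rewrite /tensop scaler_sumr -big_split; apply: eq_bigr => i _.
rewrite scaler_sumr -big_split; apply: eq_bigr => j _ /=.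
rewrite scaler_sumr -big_split; apply: eq_bigr => k _ /=.
rewrite scaler_sumr -big_split; apply: eq_bigr => l _ /=.
by rewrite !mxE scalerDl scalerA.
Qed.

HB.instance Definition _ a b c d (N : 'M[C]_a -> 'M[C]_b)
    (M : 'M[C]_c -> 'M[C]_d) :=
  GRing.isLinear.Build C 'M[C]_(a * c) 'M[C]_(b * d) _ (tensop N M)
    (tensop_is_linear N M).

Lemma tensopE a b c d (N : {linear 'M[C]_a -> 'M[C]_b})
    (M : {linear 'M[C]_c -> 'M[C]_d}) (X : 'M[C]_a) (Y : 'M[C]_c) :
  tensop N M (X *t Y) = N X *t M Y.
Proof.
have linE m n (f : {linear 'M[C]_m -> 'M[C]_n}) (A : 'M[C]_m) p q :
    f A p q = \sum_i \sum_j A i j * f (delta_mx i j) p q.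
  rewrite {1}[A]matrix_sum_delta linear_sum summxE; apply: eq_bigr => i _.
  rewrite linear_sum summxE; apply: eq_bigr => j _.
  by rewrite linearZ !mxE.
apply/matrixP => p q; case: (mxtens_indexP p) => p1 p2.
case: (mxtens_indexP q) => q1 q2; rewrite tensmxE (linE _ _ N) (linE _ _ M).
rewrite /tensop summxE mulr_suml; apply: eq_bigr => i _.
rewrite summxE mulr_suml; apply: eq_bigr => j _.
rewrite summxE mulr_sumr; apply: eq_bigr => k _.
rewrite summxE mulr_sumr; apply: eq_bigr => l _.
by rewrite mxE !tensmxE mulrACA.
Qed.

(* N^{(x) k}, typed like ntensmx: d ^ k.+2 is convertible to d * d ^ k.+1, so
   that N^{(x) 1} is N itself; N^{(x) 0} is the identity of dimension 1. *)
Fixpoint tensopX_rec a b (N : 'M[C]_a -> 'M[C]_b) k :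
    'M[C]_(a ^ k.+1) -> 'M[C]_(b ^ k.+1) :=
  if k is k'.+1 return 'M[C]_(a ^ k.+1) -> 'M[C]_(b ^ k.+1)
  then tensop N (@tensopX_rec a b N k') else N.

Definition tensopX a b (N : 'M[C]_a -> 'M[C]_b) k :
    'M[C]_(a ^ k) -> 'M[C]_(b ^ k) :=
  if k is k'.+1 return 'M[C]_(a ^ k) -> 'M[C]_(b ^ k)
  then @tensopX_rec a b N k' else idfun.

Definition completely_positive a b (N : 'M[C]_a -> 'M[C]_b) : Prop :=
  forall (c : nat) (X : 'M[C]_(a * c)),
    psdmx X -> psdmx (tensop N (@idfun 'M[C]_c) X).

Definition trace_preserving a b (N : 'M[C]_a -> 'M[C]_b) : Prop :=
  forall X : 'M[C]_a, \tr (N X) = \tr X.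

Definition quantum_channel a b (N : {linear 'M[C]_a -> 'M[C]_b}) : Prop :=
  completely_positive N /\ trace_preserving N.

Definition entanglement_breaking a b (N : 'M[C]_a -> 'M[C]_b) : Prop :=
  forall (c : nat) (X : 'M[C]_(a * c)),
    psdmx X -> separable (tensop N (@idfun 'M[C]_c) X).

End Channels.

Arguments tensopX_rec {R a b} N k _.
Arguments tensopX {R a b} N k _.

Section CommunicationValue.
Variable R : realType.
Local Notation C := R[i].

(* P y x stands for P(y|x); since probabilities are nonnegative, starting the
   maximum at 0 does not change it. *)
Definition ccv n n' (P : 'I_n' -> 'I_n -> R) : R :=
  \sum_(y < n') \big[Num.max/0]_(x < n) P y x.

(* The traces below are real when rho x is a density operator, Pi is a POVM
   and N is positive; complex.Re merely retypes them. *)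
Definition transition a b (N : 'M[C]_a -> 'M[C]_b) n n'
    (rho : 'I_n -> 'M[C]_a) (Pi : 'I_n' -> 'M[C]_b) : 'I_n' -> 'I_n -> R :=
  fun y x => complex.Re (\tr (Pi y *m N (rho x))).

Definition cv_values a b (N : 'M[C]_a -> 'M[C]_b) : set R :=
  [set r | exists (n n' : nat) (rho : 'I_n -> 'M[C]_a) (Pi : 'I_n' -> 'M[C]_b),
     [/\ (0 < n)%N, forall x, density (rho x), povm Pi
       & r = ccv (transition N rho Pi)]]%classic.

(* For a channel N with a > 0 the set is nonempty and bounded above by b,
   so sup is the genuine supremum. *)
Definition cv a b (N : 'M[C]_a -> 'M[C]_b) : R := sup (cv_values N).

Definition log2 (x : R) : R := ln x / ln 2.

Definition cv_rate a b (N : 'M[C]_a -> 'M[C]_b) (k : nat) : R :=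
  (k%:R)^-1 * log2 (cv (tensopX N k)).

Definition cv_capacity a b (N : 'M[C]_a -> 'M[C]_b) : R :=
  limn (cv_rate N).

End CommunicationValue.

(* Main.v *)
(* Call Z dominating for N if Z - N(rho) is positive semidefinite for every
   state rho. Then sum_y Tr[Pi_y N(rho_y)] <= Tr Z for every strategy, and
   conversely (strong duality, by Hahn-Banach on the space of Hermitian
   matrices) some dominating Z has Tr Z <= cv(N).
   If N is entanglement-breaking and Z1, Z2 dominate N and L, then
     Z1 (x) Z2 - (N (x) L)(rho)
       = (Z1 - N(Tr_2 rho)) (x) Z2 + (N (x) (Z2 Tr - L))(rho),
   where the map Z2 Tr - L is positive; applied to the separable operator
   (N (x) id)(rho) it gives a positive operator, so Z1 (x) Z2 dominates N (x) L.
   By induction cv(N^{(x) k}) <= cv(N)^k, while product strategies give the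
   reverse inequality; the sequence defining the capacity is constant. *)

Require Import Defs.
From HB Require Import structures.
From mathcomp Require Import all_boot all_order all_algebra.
From mathcomp Require Import all_classical all_reals all_analysis.
From mathcomp Require Import lra ring.

Set Implicit Arguments.
Unset Strict Implicit.
Unset Printing Implicit Defensive.

Import Order.TTheory GRing.Theory Num.Theory.
Import numFieldNormedType.Exports.
Local Open Scope complex_scope.
Local Open Scope sesquilinear_scope.
Local Open Scope classical_set_scope.
Local Open Scope ring_scope.

(** * Lower bounds for sums and multiples of infima *)

Section Infimum.
Variable R : realType.
Implicit Types (A B : set R) (t z : R).

Lemma le_infD A B z : A !=set0 -> B !=set0 ->
  (forall x y, A x -> B y -> z <= x + y) -> z <= inf A + inf B.
Proof.
move=> A0 B0 zAB; rewrite -lerBlDr; apply: lb_le_inf => // x Ax.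
rewrite lerBlDr -lerBlDl; apply: lb_le_inf => // y By.
by rewrite lerBlDl zAB.
Qed.

Lemma le_infZ A t z : A !=set0 -> 0 <= t ->
  (forall x, A x -> z <= t * x) -> z <= t * inf A.
Proof.
move=> A0; rewrite le_eqVlt => /predU1P[<-|t0] zA.
  by have [x Ax] := A0; have := zA _ Ax; rewrite !mul0r.
rewrite mulrC -ler_pdivrMr //; apply: lb_le_inf => // x Ax.
by rewrite ler_pdivrMr // mulrC zA.
Qed.

End Infimum.

(** * Sublinear functionals and Hahn-Banach *)

Section Sublinear.
Variables (R : realType) (V : lmodType R).
Implicit Types (q : V -> R) (v x y : V) (t : R).

Definition sublinear q :=
  (forall x y, q (x + y) <= q x + q y) /\
  (forall t x, 0 <= t -> q (t *: x) <= t * q x).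

(* [flatten q v] is the largest sublinear functional below [q] that is linear
   along the line spanned by [v] with slope [q v]. *)
Definition flatten_set q v x : set R :=
  [set q (x + t *: v) - t * q v | t in [set t | 0 <= t]].

Definition flatten q v x : R := inf (flatten_set q v x).

Lemma flatten_set0 q v x : flatten_set q v x !=set0.
Proof. by exists (q (x + 0 *: v) - 0 * q v), 0 => /=. Qed.

(** The infimum is genuine: subadditivity at [x + s *: v] and [- x], together with
    [s * q v <= q (s *: v)], bounds every value below by [- q (- x)]. *)
Lemma flatten_lb q v x t : sublinear q -> 0 <= t ->
  flatten q v x <= q (x + t *: v) - t * q v.
Proof.
move=> [qD qZ] t0; apply: ge_inf; last by exists t.
exists (- q (- x)) => _ [s /= s0 <-].
have q0 : 0 <= q 0 by have := qD 0 0; rewrite addr0 => ?; lra.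
have h1 : s * q v <= q (s *: v).
  move: s0; rewrite le_eqVlt => /predU1P[<-|s0]; first by rewrite mul0r scale0r.
  rewrite mulrC -ler_pdivlMr // mulrC.
  have := qZ s^-1 (s *: v); rewrite scalerA mulVf ?gt_eqF// scale1r; apply.
  by rewrite invr_ge0 ltW.
have := qD (x + s *: v) (- x); rewrite addrAC subrr add0r => ?; lra.
Qed.

Lemma flatten_le q v x : sublinear q -> flatten q v x <= q x.
Proof.
by move=> sq; have := flatten_lb v x sq (lexx 0);
  rewrite scale0r addr0 mul0r subr0.
Qed.

Lemma flattenN q v : sublinear q -> flatten q v (- v) <= - flatten q v v.
Proof.
move=> sq; have := flatten_lb v (- v) sq ler01.
have q0 : q 0 <= 0 by have := sq.2 0 0 (lexx 0); rewrite scale0r mul0r.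
have := flatten_le v v sq.
rewrite scale1r addNr mul1r => ? ?; lra.
Qed.

Lemma flatten_sublinear q v : sublinear q -> sublinear (flatten q v).
Proof.
move=> sq; have [qD qZ] := sq; split=> [x y|t x t0].
  apply: le_infD; [exact: flatten_set0 | exact: flatten_set0 |].
  move=> _ _ [s /= s0 <-] [t /= t0 <-].
  apply: (le_trans (flatten_lb v (x + y) sq (addr_ge0 s0 t0))).
  rewrite scalerDl addrACA mulrDl.
  have := qD (x + s *: v) (y + t *: v) => ?; lra.
apply: le_infZ => //; first exact: flatten_set0.
move=> _ [s /= s0 <-].
apply: (le_trans (flatten_lb v (t *: x) sq (mulr_ge0 t0 s0))).
rewrite -scalerA -scalerDr mulrBr mulrA lerB //.
exact: qZ.
Qed.

(** Flattening along one vector at a time works because a later flattening [p'] lies below [p]: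
    [p' (- v) <= p (- v) <= - p v <= - p' v]. *)
Lemma flatten_all q (s : seq V) : sublinear q ->
  exists p, [/\ sublinear p, forall x, p x <= q x
    & forall v, v \in s -> p (- v) <= - p v].
Proof.
move=> sq; elim: s => [|w s [p [sp pq ps]]]; first by exists q.
exists (flatten p w); split; first exact: flatten_sublinear.
  by move=> x; apply: le_trans (pq x); apply: flatten_le.
move=> v; rewrite inE => /predU1P[->|/ps pv]; first exact: flattenN.
apply: (le_trans (flatten_le _ _ sp)); apply: (le_trans pv).
by rewrite lerN2 flatten_le.
Qed.

(* Finite-dimensional Hahn-Banach: the slopes [g] define a linear functional
   dominated by [q] on the span of [e]. *)
Lemma sublinear_ge_linear (I : finType) q (e : I -> V) : sublinear q ->
  exists g : I -> R, forall a : I -> R,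
    \sum_i a i * g i <= q (\sum_i a i *: e i).
Proof.
move=> sq; have [p [sp pq ps]] := flatten_all [seq e i | i : I] sq.
have [pD pZ] := sp.
have p0 : p 0 <= 0 by have := pZ 0 0 (lexx 0); rewrite scale0r mul0r.
(* Since [p (- e i) <= - p (e i)], the bound [p (t *: e i) <= t * p (e i)] holds for [t] of either
   sign. Bounding [p] from above at minus the sum then bounds it from below at the sum. *)
exists (p \o e) => a; apply: le_trans (pq _) => /=.
have pe t i : p (t *: e i) <= t * p (e i).
  case: (lerP 0 t) => [|/ltW t0]; first exact: pZ.
  rewrite -[t]opprK scaleNr -scalerN mulNr -mulrN.
  have t0' : 0 <= - t by rewrite oppr_ge0.
  apply: (le_trans (pZ _ _ t0')).
  by apply: ler_wpM2l => //; apply: ps; apply: map_f; rewrite mem_enum.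
have pN : p (- \sum_i a i *: e i) <= - \sum_i a i * p (e i).
  rewrite -!sumrN.
  apply: (@le_trans _ _ (\sum_i p (- a i *: e i))).
    rewrite (eq_bigr (fun i => - a i *: e i)) => [|i _];
      last by rewrite scaleNr.
    elim/big_rec2: _ => [//|i y1 y2 _ IH].
    by apply: (le_trans (pD _ _)); rewrite lerD2l.
  by apply: ler_sum => i _; rewrite -mulNr; apply: pe.
have := pD (\sum_i a i *: e i) (- \sum_i a i *: e i); rewrite subrr.
have : 0 <= p 0 by have := pD 0 0; rewrite addr0 => ?; lra.
lra.
Qed.

End Sublinear.

(** * Adjoints, Kronecker products and quadratic forms *)

Section Adjoint.
Variable C : numClosedFieldType.

Lemma adjmxM m n p (A : 'M[C]_(m, n)) (B : 'M[C]_(n, p)) :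
  (A *m B)^t* = B^t* *m A^t*.
Proof. by rewrite trmx_mul map_mxM. Qed.

Lemma adjmxD m n (A B : 'M[C]_(m, n)) : (A + B)^t* = A^t* + B^t*.
Proof. by rewrite linearD map_mxD. Qed.

Lemma adjmxB m n (A B : 'M[C]_(m, n)) : (A - B)^t* = A^t* - B^t*.
Proof. by rewrite linearB map_mxB. Qed.

Lemma adjmxZ m n (z : C) (A : 'M[C]_(m, n)) : (z *: A)^t* = z^* *: A^t*.
Proof. by rewrite linearZ map_mxZ. Qed.

Lemma adjmx_tens m n p q (A : 'M[C]_(m, n)) (B : 'M[C]_(p, q)) :
  (A *t B)^t* = A^t* *t B^t*.
Proof. by rewrite trmx_tens map_mxT. Qed.

Lemma adjmx1 n : (1%:M : 'M[C]_n)^t* = 1%:M.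
Proof. by rewrite trmx1 map_mx1. Qed.

Lemma tensmxBl m n p q (A B : 'M[C]_(m, n)) (D : 'M[C]_(p, q)) :
  (A - B) *t D = A *t D - B *t D.
Proof. by apply/matrixP => i j; rewrite !mxE mulrBl. Qed.

Lemma mxtrace_tens m n (A : 'M[C]_m) (B : 'M[C]_n) :
  \tr (A *t B) = \tr A * \tr B.
Proof.
rewrite /mxtrace mulr_sum; apply: eq_bigr => k _.
by case: (mxtens_indexP k) => i j; rewrite tensmxE mxtens_indexK.
Qed.

Lemma mxtrace_delta n (i j : 'I_n) : \tr (delta_mx i j : 'M[C]_n) = (i == j)%:R.
Proof.
rewrite /mxtrace (bigD1 i) //= big1 => [|k /negbTE ki]; last by rewrite mxE ki.
by rewrite mxE eqxx addr0.
Qed.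

(** Polarization: expanding the form at [u + v] and at [u + 'i *: v] shows that [f u v] is both the
    opposite of [f v u] and equal to it. *)
Lemma quad_form_eq0 n (A : 'M[C]_n) :
  (forall u : 'cV[C]_n, (u^t* *m A *m u) 0 0 = 0) -> A = 0.
Proof.
move=> A0; apply/matrixP => i j; rewrite [RHS]mxE.
pose f (u v : 'cV[C]_n) := (u^t* *m A *m v) 0 0.
have fD (u v : 'cV[C]_n) (z : C) : f (u + z *: v) (u + z *: v) =
    f u u + z * f u v + z^* * f v u + z^* * z * f v v.
  rewrite /f adjmxD adjmxZ !mulmxDl !mulmxDr -!scalemxAl -!scalemxAr !mxE.
  by rewrite !addrA mulrA.
have -> : A i j = f (delta_mx i 0) (delta_mx j 0).
  by rewrite /f -map_trmx map_delta_mx trmx_delta -rowE -colE !mxE.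
set u := delta_mx i 0; set v := delta_mx j 0.
have f0 w : f w w = 0 by exact: A0.
have := fD u v 1; have := fD u v 'i; rewrite !f0 conjC1 conjCi !mul1r.
rewrite !mulr0 !addr0 !add0r => h1 h2.
have i0 : 'i != 0 :> C by rewrite neq0Ci.
have h3 : f u v = f v u.
  by apply: (mulfI i0); apply/eqP; rewrite -subr_eq0 -mulNr -h1.
move: h2; rewrite -h3 -mulr2n => /esym/eqP.
by rewrite mulrn_eq0 /= => /eqP.
Qed.

End Adjoint.

(** * Positive semidefinite matrices *)

Section Psd.
Variable R : realType.
Local Notation C := R[i].

(** The quadratic form of [A] is real, so that of [A^t* - A] vanishes. *)
Lemma psdmx_herm n (A : 'M[C]_n) : psdmx A -> A^t* = A.
Proof.
move=> pA; apply/eqP; rewrite -subr_eq0; apply/eqP/quad_form_eq0 => u.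
have -> : u^t* *m (A^t* - A) *m u = (u^t* *m A *m u)^t* - u^t* *m A *m u.
  by rewrite !adjmxM trmxCK mulmxBr mulmxBl mulmxA.
move: (_ *m u) (pA u) => x x0; rewrite !mxE.
by have /CrealP -> := ger0_real x0; rewrite subrr.
Qed.

Lemma psdmx_gram m n (B : 'M[C]_(m, n)) : psdmx (B^t* *m B).
Proof.
move=> u; rewrite mulmxA -adjmxM -mulmxA mxE sumr_ge0 // => i _.
by rewrite !mxE mulrC mul_conjC_ge0.
Qed.

Lemma psdmxD n (A B : 'M[C]_n) : psdmx A -> psdmx B -> psdmx (A + B).
Proof. by move=> pA pB u; rewrite mulmxDr mulmxDl mxE addr_ge0 ?pA ?pB. Qed.

Lemma psdmx0 n : psdmx (0 : 'M[C]_n).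
Proof. by move=> u; rewrite mulmx0 mul0mx mxE. Qed.

Lemma psdmx1 n : psdmx (1%:M : 'M[C]_n).
Proof. by rewrite -[1%:M]mulmx1 -{1}(adjmx1 C n); exact: psdmx_gram. Qed.

Lemma psdmxZ n (z : C) (A : 'M[C]_n) : 0 <= z -> psdmx A -> psdmx (z *: A).
Proof. by move=> z0 pA u; rewrite -scalemxAr -scalemxAl mxE mulr_ge0 ?pA. Qed.

Lemma psdmx_sum n (I : Type) (s : seq I) (P : pred I) (F : I -> 'M[C]_n) :
  (forall i, P i -> psdmx (F i)) -> psdmx (\sum_(i <- s | P i) F i).
Proof.
by move=> pF; elim/big_ind: _ => //; [exact: psdmx0 | exact: psdmxD].
Qed.

Lemma psdmx_conj m n (A : 'M[C]_n) (B : 'M[C]_(n, m)) :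
  psdmx A -> psdmx (B^t* *m A *m B).
Proof. by move=> pA u; rewrite !mulmxA -adjmxM -mulmxA pA. Qed.

Lemma diag_psdmx n (d : 'rV[C]_n) : (forall i, 0 <= d 0 i) -> psdmx (diag_mx d).
Proof.
move=> d0 u; rewrite -mulmxA mul_diag_mx mxE sumr_ge0 // => i _.
by rewrite !mxE mulrCA mulr_ge0 // mulrC mul_conjC_ge0.
Qed.

Lemma herm_spectral n (A : 'M[C]_n) : A^t* = A ->
  exists (U : 'M[C]_n) (d : 'rV[R]_n), [/\ U^t* *m U = 1%:M, U *m U^t* = 1%:M
    & A = U^t* *m diag_mx (map_mx (real_complex R) d) *m U].
Proof.
move=> Ah; have hA : A \is hermsymmx.
  by apply/is_hermitianmxP; rewrite expr0 scale1r Ah.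
have uU := spectral_unitarymx A; exists (spectralmx A).
have UU := unitarymxP uU.
exists (map_mx (@complex.Re R) (spectral_diag A)); split=> //.
  by apply: mulmx1C.
have /orthomx_spectralP := hermitian_normalmx hA.
rewrite invmx_unitary // => {1}->; congr (_ *m diag_mx _ *m _).
apply/rowP => i; rewrite !mxE RRe_real //.
by have /mxOverP := hermitian_spectral_diag_real hA; apply.
Qed.

Lemma psdmx_spectral n (A : 'M[C]_n) : psdmx A ->
  exists (U : 'M[C]_n) (d : 'rV[R]_n), [/\ U^t* *m U = 1%:M,
    forall i, 0 <= d 0 i
    & A = U^t* *m diag_mx (map_mx (real_complex R) d) *m U].
Proof.
move=> pA; have [U [d [UU UU' Ae]]] := herm_spectral (psdmx_herm pA).
exists U, d; split=> // i; rewrite -ler0c.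
have := psdmx_conj (U^t*) pA (delta_mx i 0).
rewrite trmxCK {1}Ae !mulmxA -[_ *m U *m U^t*]mulmxA UU' mulmx1.
rewrite -[_ *m U *m U^t*]mulmxA UU' mulmx1.
by rewrite -map_trmx map_delta_mx trmx_delta -rowE -colE !mxE eqxx mulr1n.
Qed.

(** The factor is the square root of the diagonal part times the unitary. Gram form makes positivity
    of tensor products and of traces of products immediate. *)
Lemma psdmx_gramP n (A : 'M[C]_n) : psdmx A ->
  exists B : 'M[C]_n, A = B^t* *m B.
Proof.
move=> /psdmx_spectral[U [d [_ d0 ->]]].
exists (diag_mx (map_mx (fun x => (Num.sqrt x)%:C) d) *m U).
rewrite adjmxM !mulmxA; congr (_ *m _); rewrite -!mulmxA; congr (_ *m _).
rewrite tr_diag_mx map_diag_mx mulmx_diag; congr diag_mx.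
apply/rowP => i; rewrite !mxE.
rewrite /= conj_Creal ?complex_real //.
by rewrite -rmorphM /= -expr2 sqr_sqrtr.
Qed.

Lemma psdmx_tens m n (A : 'M[C]_m) (B : 'M[C]_n) :
  psdmx A -> psdmx B -> psdmx (A *t B).
Proof.
move=> /psdmx_gramP[D ->] /psdmx_gramP[E ->].
by rewrite -tensmx_mul -adjmx_tens; exact: psdmx_gram.
Qed.

(** With [A = D^t* *m D], cyclicity turns the trace into a sum of quadratic forms of [B] at the
    adjoint rows of [D]. *)
Lemma mxtrace_psdM_ge0 n (A B : 'M[C]_n) :
  psdmx A -> psdmx B -> 0 <= \tr (A *m B).
Proof.
move=> /psdmx_gramP[D ->] pB; rewrite -mulmxA mxtrace_mulC sumr_ge0 // => i _.
have := pB ((row i D)^t*); rewrite trmxCK -row_mul; congr (0 <= _).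
rewrite !mxE; apply: eq_bigr => j _.
by congr (_ * _); rewrite !mxE.
Qed.

Lemma mxtrace_psd_ge0 n (A : 'M[C]_n) : psdmx A -> 0 <= \tr A.
Proof. by move=> pA; rewrite -[A]mulmx1 mxtrace_psdM_ge0 //; exact: psdmx1. Qed.

Lemma diag_conj_le n (U : 'M[C]_n) (d : 'rV[R]_n) (s : R) :
  U^t* *m U = 1%:M -> (forall i, d 0 i <= s) ->
  psdmx (s%:C *: 1%:M - U^t* *m diag_mx (map_mx (real_complex R) d) *m U).
Proof.
move=> UU ds; rewrite -UU scalemxAl -[U^t* in X in X - _]mulmx1 scalemxAr.
rewrite -mulmxBl -mulmxBr; apply: psdmx_conj.
rewrite scalemx1 -diag_const_mx -raddfB /=; apply: diag_psdmx => i.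
by rewrite !mxE -rmorphB ler0c subr_ge0.
Qed.

Lemma herm_bounded n (A : 'M[C]_n) : A^t* = A ->
  exists s : R, psdmx (s%:C *: 1%:M - A).
Proof.
move=> /herm_spectral[U [d [UU _ ->]]]; exists (\sum_i `|d 0 i|).
apply: diag_conj_le => // i; rewrite (bigD1 i) //=.
by rewrite (le_trans (ler_norm _)) // lerDl sumr_ge0.
Qed.

(** The eigenvalues are nonnegative with sum 1, hence each is at most 1. *)
Lemma density_le1 n (A : 'M[C]_n) : density A -> psdmx (1%:M - A).
Proof.
move=> [/psdmx_spectral[U [d [UU d0 ->]]]].
rewrite mxtrace_mulC mulmxA (mulmx1C UU) mul1mx mxtrace_diag => tr1.
rewrite -[1%:M]scale1r; apply: diag_conj_le => // i; rewrite -lecR.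
rewrite -[X in _ <= X]tr1 (bigD1 i) //= mxE lerDl sumr_ge0 // => j _.
by rewrite mxE ler0c.
Qed.

End Psd.

(** * Real parts of complex numbers *)

Section RealPart.
Variable R : realType.
Local Notation C := R[i].
Local Notation Re := (@complex.Re R).

Lemma ReD (x y : C) : Re (x + y) = Re x + Re y.
Proof. by case: x y => [? ?] [? ?]. Qed.

Lemma ReN (x : C) : Re (- x) = - Re x.
Proof. by case: x. Qed.

Lemma Re_sum (I : Type) (s : seq I) (P : pred I) (F : I -> C) :
  Re (\sum_(i <- s | P i) F i) = \sum_(i <- s | P i) Re (F i).
Proof. exact: (big_morph Re ReD (erefl : Re 0 = 0)). Qed.

Lemma Re_ZM (t : R) (x : C) : Re (t%:C * x) = t * Re x.
Proof. by case: x => a b /=; rewrite mul0r subr0. Qed.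

Lemma Re_ge0 (x : C) : 0 <= x -> 0 <= Re x.
Proof. by rewrite lecE => /andP[]. Qed.

Lemma ReM_ge0 (x y : C) : 0 <= x -> 0 <= y -> Re (x * y) = Re x * Re y.
Proof. by move=> /ger0_real/RRe_real {1}<- _; rewrite Re_ZM. Qed.

End RealPart.

(** * Real coordinates on Hermitian matrices *)

Section HermOf.
Variables (R : realType) (n : nat).
Local Notation C := R[i].
Implicit Types A G : 'M[R]_n.

(* An R-linear isomorphism from real matrices to Hermitian ones: twice the
   symmetric part of [A] becomes the real part, twice its antisymmetric part
   the imaginary part. *)
Definition herm_of A : 'M[C]_n :=
  \matrix_(i, j) ((A i j + A j i) +i* (A i j - A j i)).

Lemma herm_ofD A B : herm_of (A + B) = herm_of A + herm_of B.
Proof.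
by apply/matrixP => i j; rewrite !mxE; congr (_ +i* _); rewrite ?opprD addrACA.
Qed.

Lemma herm_ofZ (t : R) A : herm_of (t *: A) = t%:C *: herm_of A.
Proof.
apply/matrixP => i j; rewrite !mxE; apply/eqP; rewrite eq_complex /=.
by rewrite !mul0r subr0 addr0 mulrDr mulrBr !eqxx.
Qed.

Lemma herm_of_adj A : (herm_of A)^t* = herm_of A.
Proof.
apply/matrixP => i j; rewrite !mxE; apply/eqP; rewrite eq_complex /=.
by rewrite addrC eqxx opprB eqxx.
Qed.

Lemma herm_of_surj (H : 'M[C]_n) : H^t* = H -> exists A, herm_of A = H.
Proof.
move=> Hh.
exists (\matrix_(i, j) ((complex.Re (H i j) + complex.Im (H i j)) / 2)).
apply/matrixP => i j; rewrite !mxE.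
have -> : H j i = conjc (H i j) by rewrite -{1}Hh !mxE.
by case: (H i j) => x y /=; congr (_ +i* _); lra.
Qed.

(** Up to the factor 4, the trace pairing is the standard inner product of real matrices, so real
    linear functionals on Hermitian matrices are traces against Hermitian matrices. *)
Lemma tr_herm_ofM G A :
  complex.Re (\tr (herm_of G *m herm_of A)) = 4 * \sum_i \sum_j G i j * A i j.
Proof.
rewrite /mxtrace Re_sum.
transitivity (\sum_i \sum_j (2 * (G i j * A i j) + 2 * (G j i * A j i))).
  apply: eq_bigr => i _; rewrite mxE Re_sum; apply: eq_bigr => j _.
  by rewrite !mxE /=; ring.
under eq_bigr do rewrite big_split /=.
rewrite big_split /= [X in _ + X]exchange_big /=.
rewrite mulr_sumr -big_split /=; apply: eq_bigr => i _.
by rewrite mulr_sumr -big_split /=; apply: eq_bigr => j _; ring.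
Qed.

End HermOf.

(** * Scores of strategies and dominating operators *)

Section Scores.
Variables (R : realType) (a b : nat).
Local Notation C := R[i].
Variable N : 'M[C]_a -> 'M[C]_b.

Definition psd_on_states := forall rho, density rho -> psdmx (N rho).

(** Each outcome [y] comes with its own input [rho y]; taking the best input for each outcome
    removes the maximum from the communication value. *)
Definition score n (Pi : 'I_n -> 'M[C]_b) (rho : 'I_n -> 'M[C]_a) : R :=
  \sum_y complex.Re (\tr (Pi y *m N (rho y))).

Definition dominates (Z : 'M[C]_b) :=
  forall rho, density rho -> psdmx (Z - N rho).

Lemma exists_density (a_gt0 : (0 < a)%N) : exists rho : 'M[C]_a, density rho.
Proof.
pose i := Ordinal a_gt0; exists (delta_mx i i); split.
  have -> : delta_mx i i =
      (delta_mx 0 i)^t* *m delta_mx (0 : 'I_1) i :> 'M[C]_a.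
    by rewrite -map_trmx map_delta_mx trmx_delta mul_delta_mx.
  exact: psdmx_gram.
by rewrite mxtrace_delta eqxx.
Qed.

End Scores.

(** * Strong duality *)

Section Duality.
Variables (R : realType) (a b : nat).
Local Notation C := R[i].
Local Notation Re := (@complex.Re R).
Variable N : {linear 'M[C]_a -> 'M[C]_b}.

(* Scores of families of effects that sum to [W] rather than to the identity. *)
Definition cone_score (W : 'M[C]_b) (r : R) : Prop :=
  exists l : seq ('M[C]_b * 'M[C]_a),
    [/\ forall p, p \in l -> psdmx p.1 /\ density p.2,
        \sum_(p <- l) p.1 = W & \sum_(p <- l) Re (\tr (p.1 *m N p.2)) = r].

Lemma cone_scoreD W r W' r' :
  cone_score W r -> cone_score W' r' -> cone_score (W + W') (r + r').
Proof.
move=> [l [hl <- <-]] [l' [hl' <- <-]]; exists (l ++ l'); split.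
- by move=> p; rewrite mem_cat => /orP[/hl|/hl'].
- by rewrite big_cat.
- by rewrite big_cat.
Qed.

Lemma cone_scoreZ (t : R) W r : 0 <= t ->
  cone_score W r -> cone_score (t%:C *: W) (t * r).
Proof.
move=> t0 [l [hl <- <-]]; exists [seq (t%:C *: p.1, p.2) | p <- l]; split.
- move=> _ /mapP[p /hl[p1 p2] ->]; split=> //=.
  by apply: psdmxZ => //; rewrite ler0c.
- by rewrite big_map scaler_sumr.
- rewrite big_map mulr_sumr; apply: eq_bigr => p _ /=.
  by rewrite -scalemxAl mxtraceZ Re_ZM.
Qed.

Lemma cone_score1 W rho : psdmx W -> density rho ->
  cone_score W (Re (\tr (W *m N rho))).
Proof.
move=> pW drho; exists [:: (W, rho)]; split; rewrite ?big_seq1 //.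
by move=> p; rewrite inE => /eqP ->.
Qed.

Lemma cone_score0 : cone_score 0 0.
Proof. by exists [::]; split; rewrite ?big_nil. Qed.

Variable c : R.
Hypothesis score_le : forall n (Pi : 'I_n -> 'M[C]_b) rho,
  povm Pi -> (forall y, density (rho y)) -> score N Pi rho <= c.

(** Scaling by [t^-1] gives effects with sum the identity, a POVM indexed by the positions of the
    list. *)
Lemma cone_score_le t r : 0 < t -> cone_score (t%:C *: 1%:M) r -> r <= t * c.
Proof.
move=> t0 /(cone_scoreZ (ltW (_ : 0 < t^-1))); rewrite invr_gt0 => /(_ t0).
rewrite scalerA -rmorphM mulVf ?gt_eqF // scale1r => -[l [hl sl rl]].
rewrite -ler_pdivrMl // -rl.
pose T := in_tuple l.
have hT i : psdmx (tnth T i).1 /\ density (tnth T i).2.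
  by apply: hl; exact: mem_tnth.
have := @score_le (size l) (fun i => (tnth T i).1) (fun i => (tnth T i).2).
rewrite /score -(big_tnth _ _ l predT (fun p => Re (\tr (p.1 *m N p.2)))).
apply; last by move=> y; case: (hT y).
split; first by move=> y; case: (hT y).
by rewrite -(big_tnth _ _ l predT (fun p => p.1)).
Qed.

(** The infimum over these decompositions is at most [c] at the identity and at most minus any score
    of [W] at [- W]. A linear functional below it is therefore the trace against a dominating matrix
    of trace at most [c]. *)
Definition gauge_set (A : 'M[R]_b) : set R :=
  [set v | exists s W r, [/\ cone_score W r,
     s%:C *: 1%:M - W = herm_of A & v = s * c - r]].

Definition gauge A := inf (gauge_set A).

Hypotheses (a_gt0 : (0 < a)%N) (b_gt0 : (0 < b)%N).
Hypothesis N_psd : psd_on_states N.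

Lemma herm_of_split A : exists s W r,
  [/\ psdmx W, 0 <= r, cone_score W r & s%:C *: 1%:M - W = herm_of A].
Proof.
have [rho drho] := exists_density R a_gt0.
have [s ps] := herm_bounded (herm_of_adj A).
exists s, (s%:C *: 1%:M - herm_of A).
exists (Re (\tr ((s%:C *: 1%:M - herm_of A) *m N rho))); split=> //.
- by apply/Re_ge0/mxtrace_psdM_ge0 => //; exact: N_psd.
- exact: cone_score1.
- by rewrite opprB addrCA subrr addr0.
Qed.

Lemma cone_score_psd W r : cone_score W r -> psdmx W.
Proof.
move=> [l [hl <- _]]; rewrite big_seq; apply: psdmx_sum => p pl.
by case: (hl p pl).
Qed.

Lemma gauge_set0 A : gauge_set A !=set0.
Proof.
have [s [W [r [_ _ K e]]]] := herm_of_split A.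
by exists (s * c - r), s, W, r.
Qed.

(** A fixed decomposition of [- A] added to any one of [A] yields effects whose sum is a multiple of
    the identity, and their score is bounded by [cone_score_le]. *)
Lemma gauge_has_lb A : has_lbound (gauge_set A).
Proof.
have [s [W [r [pW r0 K e]]]] := herm_of_split (- A).
have [rho drho] := exists_density R a_gt0.
(* One more effect, the identity, makes the coefficient [t + s + 1] positive even when
   [t + s = 0]. *)
have K1 := cone_score1 (@psdmx1 R b) drho.
set r1 := Re _ in K1; have r10 : 0 <= r1.
  by apply/Re_ge0/mxtrace_psdM_ge0; [exact: psdmx1 | exact: N_psd].
exists (- (s + 1) * c) => _ [t [W' [r' [K' e' ->]]]].
have eN : herm_of (- A) = - herm_of A.
  by rewrite -scaleN1r herm_ofZ rmorphN1 scaleN1r.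
have eW : (t + s)%:C *: 1%:M = W' + W.
  rewrite rmorphD scalerDl -[t%:C *: _](subrK W') e' -[s%:C *: _](subrK W) e eN.
  by rewrite addrACA subrr add0r.
have ts : 0 <= t + s.
  have pWW : psdmx ((t + s)%:C *: 1%:M : 'M[C]_b).
    by rewrite eW; apply: psdmxD => //; apply: cone_score_psd K'.
  have := mxtrace_psd_ge0 pWW.
  by rewrite mxtraceZ mxtrace1 pmulr_lge0 ?ltr0n // ler0c.
have eT : W' + W + 1%:M = (t + s + 1)%:C *: 1%:M.
  by rewrite -eW [in RHS]rmorphD rmorph1 scalerDl scale1r.
have := cone_scoreD (cone_scoreD K' K) K1; rewrite eT.
move=> /cone_score_le; have ts1 : 0 < t + s + 1 by lra.
by move=> /(_ ts1) => ?; lra.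
Qed.

Lemma gauge_sublinear : sublinear gauge.
Proof.
split=> [A B|t A t0].
  apply: le_infD; [exact: gauge_set0 | exact: gauge_set0 |].
  move=> _ _ [s [W [r [K e ->]]]] [s' [W' [r' [K' e' ->]]]].
  apply: ge_inf; first exact: gauge_has_lb.
  exists (s + s'), (W + W'), (r + r'); split.
  - exact: cone_scoreD.
  - by rewrite herm_ofD -e -e' rmorphD scalerDl opprD addrACA.
  - by rewrite opprD addrACA mulrDl.
apply: le_infZ => //; first exact: gauge_set0.
move=> _ [s [W [r [K e ->]]]]; apply: ge_inf; first exact: gauge_has_lb.
exists (t * s), (t%:C *: W), (t * r); split.
- exact: cone_scoreZ.
- by rewrite herm_ofZ -e scalerBr scalerA rmorphM.
- by rewrite mulrBr mulrA.
Qed.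

Lemma exists_dominating : exists Z, dominates N Z /\ Re (\tr Z) <= c.
Proof.
pose e (ij : 'I_b * 'I_b) : 'M[R]_b := delta_mx ij.1 ij.2.
have [g hg] := sublinear_ge_linear e gauge_sublinear.
pose G : 'M[R]_b := \matrix_(i, j) g (i, j).
(* The scalar cancels the factor 4 of [tr_herm_ofM]. *)
pose Z := herm_of (4^-1 *: G).
have trZ A : Re (\tr (Z *m herm_of A)) <= gauge A.
  rewrite tr_herm_ofM; have := hg (fun ij => A ij.1 ij.2).
  rewrite -[X in gauge X](pair_bigA _ (fun i j => A i j *: delta_mx i j)) /=.
  rewrite -matrix_sum_delta; apply: le_trans.
  rewrite pair_bigA mulr_sumr ler_sum // => -[i j] _.
  by rewrite !mxE /=; lra.
exists Z; split.
  move=> rho drho u.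
  (* Testing the functional at [- W] gives a nonnegative real part for the quadratic form of
     [Z - N rho] at [u]. *)
  pose W := u *m u^t*; have pW : psdmx W.
    by rewrite /W -{1}[u]trmxCK; exact: psdmx_gram.
  have [A eA] := herm_of_surj (psdmx_herm pW).
  have eNA : herm_of (- A) = - W.
    by rewrite -scaleN1r herm_ofZ rmorphN1 scaleN1r eA.
  have qA : gauge (- A) <= - Re (\tr (W *m N rho)).
    apply: ge_inf; first exact: gauge_has_lb.
    exists 0, W, (Re (\tr (W *m N rho))); split.
    - exact: cone_score1.
    - by rewrite scale0r sub0r eNA.
    - by rewrite mul0r sub0r.
  have := le_trans (trZ (- A)) qA.
  rewrite eNA mulmxN linearN ReN lerN2 mxtrace_mulC -subr_ge0 -ReN -ReD.
  rewrite -linearB -mulmxBl /= mulmxA mxtrace_mulC mulmxA trace_mx11.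
  (* The order of [C] also requires a zero imaginary part, which follows from Hermiticity. *)
  have hZ : (Z - N rho)^t* = Z - N rho.
    by rewrite adjmxB herm_of_adj (psdmx_herm (N_psd drho)).
  move=> Re0; rewrite lecE Re0 andbT eq_sym.
  have : (u^t* *m (Z - N rho) *m u)^t* = u^t* *m (Z - N rho) *m u.
    by rewrite !adjmxM trmxCK hZ mulmxA.
  move: (_ *m u) => X hX.
  have /RIm_real : X 0 0 \is Num.real.
    by apply/CrealP; rewrite -[in RHS]hX !mxE.
  by move=> [->].
(* The trace bound is the functional evaluated at the identity. *)
have [A eA] := herm_of_surj (adjmx1 C b).
rewrite -[Z]mulmx1 -eA; apply: le_trans (trZ A) _.
apply: ge_inf; first exact: gauge_has_lb.
exists 1, 0, 0; split; first exact: cone_score0.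
  by rewrite eA scale1r subr0.
by rewrite mul1r subr0.
Qed.

End Duality.

(** * The communication value as a supremum of scores *)

Section CommunicationValueScores.
Variables (R : realType) (a b : nat).
Local Notation C := R[i].
Variable N : 'M[C]_a -> 'M[C]_b.
Hypotheses (a_gt0 : (0 < a)%N) (b_gt0 : (0 < b)%N).
Hypothesis N_psd : psd_on_states N.

Lemma score_le_dominated Z n (Pi : 'I_n -> 'M[C]_b) rho :
  dominates N Z -> povm Pi -> (forall y, density (rho y)) ->
  score N Pi rho <= complex.Re (\tr Z).
Proof.
move=> domZ [Pi0 Pi1] drho; rewrite -[Z]mul1mx -Pi1 mulmx_suml.
rewrite (raddf_sum (@mxtrace _ _)) Re_sum.
apply: ler_sum => y _; rewrite -subr_ge0 -ReN -ReD -linearB -mulmxBr /=.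
by apply/Re_ge0/mxtrace_psdM_ge0 => //; exact: domZ.
Qed.

Lemma povm1 : povm (fun _ : 'I_1 => 1%:M : 'M[C]_b).
Proof. by split=> [y|]; [exact: psdmx1 | rewrite big_ord1]. Qed.

Lemma cv_values_neq0 : cv_values N !=set0.
Proof.
have [rho drho] := exists_density R a_gt0.
by eexists; exists 1, 1, (fun=> rho), (fun=> 1%:M); split=> //; exact: povm1.
Qed.

Lemma cv_values_score r : cv_values N r -> exists n (Pi : 'I_n -> 'M[C]_b) rho,
  [/\ povm Pi, forall y, density (rho y) & r = score N Pi rho].
Proof.
move=> [n [n' [rho [Pi [n_gt0 drho pPi ->]]]]].
case: n n_gt0 rho drho => // n _ rho drho.
pose best y := [arg max_(x > ord0) transition N rho Pi y x]%O.
exists n', Pi, (rho \o best); split=> //; first by move=> y; exact: drho.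
(* The maximum started at 0 is attained at [best y] because the transition values are
   nonnegative. *)
apply: eq_bigr => y _; rewrite /= (@bigmax_eq_arg _ _ _ _ ord0) // => x _.
apply/Re_ge0/mxtrace_psdM_ge0; first by case: pPi.
exact: N_psd.
Qed.

Lemma cv_le c :
  (forall n (Pi : 'I_n -> 'M[C]_b) rho,
    povm Pi -> (forall y, density (rho y)) -> score N Pi rho <= c) ->
  cv N <= c.
Proof.
move=> le_c; apply: ge_sup; first exact: cv_values_neq0.
by move=> r /cv_values_score[n [Pi [rho [pPi drho ->]]]]; exact: le_c.
Qed.

(** The score of a strategy is at most its classical value with maxima, and [Z] bounds all values,
    so the supremum is an upper bound. *)
Lemma score_le_cv Z n (Pi : 'I_n -> 'M[C]_b) rho :
  dominates N Z -> povm Pi -> (forall y, density (rho y)) ->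
  score N Pi rho <= cv N.
Proof.
move=> domZ pPi drho.
apply: (@le_trans _ _ (ccv (transition N rho Pi))).
  by apply: ler_sum => y _; exact: (le_bigmax _ (transition N rho Pi y) y).
apply: ub_le_sup.
  exists (complex.Re (\tr Z)) => r /cv_values_score[m [Ga [tau [pGa dtau ->]]]].
  exact: score_le_dominated.
exists n, n, rho, Pi; split=> //.
(* An empty POVM is impossible: its sum 0 would have trace [b]. *)
case: n Pi rho pPi drho => // Pi rho [_ /(congr1 mxtrace)] /esym/eqP.
by rewrite big_ord0 mxtrace1 linear0 pnatr_eq0 eqn0Ngt b_gt0.
Qed.

End CommunicationValueScores.

(** * Domination for tensor products with an entanglement-breaking map *)

Section EntanglementBreaking.
Variable R : realType.
Local Notation C := R[i].

Lemma pure_density n (A : 'M[C]_n) : pure_state A -> density A.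
Proof.
move=> [u [u1 ->]]; split; first by rewrite -{1}[u]trmxCK; exact: psdmx_gram.
by rewrite mxtrace_mulC u1 mxtrace1.
Qed.

Lemma tensmxBr m n p q (A : 'M[C]_(m, n)) (B D : 'M[C]_(p, q)) :
  A *t (B - D) = A *t B - A *t D.
Proof. by apply/matrixP => i j; rewrite !mxE mulrBr. Qed.

Lemma tensmx_suml m n p q (I : finType) (F : I -> 'M[C]_(m, n))
    (B : 'M[C]_(p, q)) :
  (\sum_i F i) *t B = \sum_i (F i *t B).
Proof.
apply/matrixP => i j; rewrite mxE !summxE mulr_suml.
by apply: eq_bigr => k _; rewrite mxE.
Qed.

Lemma tensmxZl m n p q (z : C) (A : 'M[C]_(m, n)) (B : 'M[C]_(p, q)) :
  (z *: A) *t B = z *: (A *t B).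
Proof. by apply/matrixP => i j; rewrite !mxE mulrA. Qed.

Lemma tensop_factor a b c d (N : 'M[C]_a -> 'M[C]_b)
    (L : {linear 'M[C]_c -> 'M[C]_d}) X :
  tensop N L X = tensop idfun L (tensop N idfun X).
Proof.
rewrite [tensop N idfun X]/tensop !linear_sum; apply: eq_bigr => i _.
rewrite linear_sum; apply: eq_bigr => j _; rewrite linear_sum.
apply: eq_bigr => k _; rewrite linear_sum; apply: eq_bigr => l _.
by rewrite linearZ /= (tensopE idfun L).
Qed.

(** After [N] acts on its factor the operator is separable, so [L] meets only product states, where
    positivity on states suffices. *)
Lemma EB_tensop_psd a b c d (N : 'M[C]_a -> 'M[C]_b)
    (L : {linear 'M[C]_c -> 'M[C]_d}) X :
  entanglement_breaking N -> psd_on_states L ->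
  psdmx X -> psdmx (tensop N L X).
Proof.
move=> EB pL /EB[m [t [phi [psi [t0 pphi ppsi e]]]]].
rewrite tensop_factor e linear_sum; apply: psdmx_sum => i _.
rewrite linearZ /= (tensopE idfun L) /=; apply: psdmxZ; first by rewrite ler0c.
apply: psdmx_tens; first by have [] := pure_density (pphi i).
by apply: pL; exact: pure_density.
Qed.

(** The linear extension of [Z - L X] from states to all matrices; it is positive on states when [Z]
    dominates [L]. *)
Definition slack c d (Z : 'M[C]_d) (L : 'M[C]_c -> 'M[C]_d) X :=
  \tr X *: Z - L X.

Lemma slack_is_linear c d (Z : 'M[C]_d) (L : {linear 'M[C]_c -> 'M[C]_d}) :
  linear (slack Z L).
Proof.
move=> x X Y; rewrite /slack [L _]linearP mxtraceD mxtraceZ scalerDl scalerBr.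
by rewrite scalerA opprD addrACA.
Qed.

HB.instance Definition _ c d (Z : 'M[C]_d) (L : {linear 'M[C]_c -> 'M[C]_d}) :=
  GRing.isLinear.Build C 'M[C]_c 'M[C]_d _ (slack Z L) (slack_is_linear Z L).

Definition ptrace a c (X : 'M[C]_(a * c)) : 'M[C]_a :=
  \matrix_(i, j) \sum_k X (mxtens_index (i, k)) (mxtens_index (j, k)).

Lemma psdmx_mxsub m n (f : 'I_m -> 'I_n) (A : 'M[C]_n) :
  psdmx A -> psdmx (mxsub f f A).
Proof.
move=> /psdmx_gramP[B ->].
have -> : mxsub f f (B^t* *m B) = (colsub f B)^t* *m colsub f B.
  by apply/matrixP => i j; rewrite !mxE; apply: eq_bigr => k _; rewrite !mxE.
exact: psdmx_gram.
Qed.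

Lemma ptrace_density a c (X : 'M[C]_(a * c)) : density X -> density (ptrace X).
Proof.
move=> [pX trX]; split; last first.
  rewrite -trX /mxtrace; under eq_bigr do rewrite mxE.
  rewrite pair_bigA /= (reindex (@mxtens_unindex a c)); last first.
    by exists (@mxtens_index a c) => i _;
      rewrite (mxtens_indexK, mxtens_unindexK).
  apply: eq_bigr => k _.
  by case: (mxtens_indexP k) => i j; rewrite mxtens_indexK.
(* The partial trace is a sum of principal submatrices, one per basis vector of the traced
   factor. *)
have -> : ptrace X = \sum_k mxsub (fun i => mxtens_index (i, k))
    (fun i => mxtens_index (i, k)) X.
  apply/matrixP => i j; rewrite mxE summxE.
  by apply: eq_bigr => k _; rewrite mxE.
by apply: psdmx_sum => k _; exact: psdmx_mxsub.
Qed.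

Lemma tensop_dominated a b c d (N : {linear 'M[C]_a -> 'M[C]_b})
    (L : {linear 'M[C]_c -> 'M[C]_d}) Z1 Z2 :
  entanglement_breaking N -> psdmx Z2 ->
  dominates N Z1 -> dominates L Z2 -> dominates (tensop N L) (Z1 *t Z2).
Proof.
move=> EB pZ2 dom1 dom2 rho drho.
have -> : Z1 *t Z2 - tensop N L rho =
    (Z1 - N (ptrace rho)) *t Z2 + tensop N (slack Z2 L) rho.
  rewrite tensmxBl -addrA; congr (_ + _).
  have -> : tensop N (slack Z2 L) rho = N (ptrace rho) *t Z2 - tensop N L rho.
    (* On matrix units the trace keeps only the terms with [k = l], which are those of the partial
       trace. *)
    have -> : N (ptrace rho) *t Z2 = tensop N (fun X => \tr X *: Z2) rho.
      rewrite [ptrace rho]matrix_sum_delta linear_sum /= /tensop.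
      rewrite tensmx_suml; apply: eq_bigr => i _.
      rewrite linear_sum tensmx_suml; apply: eq_bigr => j _.
      rewrite linearZ /= mxE scaler_suml tensmx_suml; apply: eq_bigr => k _.
      rewrite (bigD1 k) //= big1 => [|l lk].
        by rewrite addr0 mxtrace_delta eqxx scale1r tensmxZl.
      by rewrite mxtrace_delta eq_sym (negbTE lk) scale0r tensmx0 scaler0.
    rewrite /tensop -!sumrB; apply: eq_bigr => i _.
    rewrite -!sumrB; apply: eq_bigr => j _.
    rewrite -!sumrB; apply: eq_bigr => k _.
    rewrite -!sumrB; apply: eq_bigr => l _.
    by rewrite -scalerBr -tensmxBr.
  by rewrite addKr.
apply: psdmxD.
  by apply: psdmx_tens => //; apply: dom1; exact: ptrace_density.
apply: EB_tensop_psd => //; last by case: drho.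
by move=> tau dtau; rewrite /= /slack dtau.2 scale1r; exact: dom2.
Qed.

End EntanglementBreaking.

(** * Product strategies and supermultiplicativity *)

Section ProductStrategies.
Variable R : realType.
Local Notation C := R[i].

Lemma tensmx11 m n : (1%:M : 'M[C]_m) *t (1%:M : 'M[C]_n) = 1%:M.
Proof.
apply/matrixP => p q; case: (mxtens_indexP p) => i k.
case: (mxtens_indexP q) => j l; rewrite tensmxE !mxE.
by rewrite (can_eq (@mxtens_indexK m n)) xpair_eqE -natrM mulnb.
Qed.

Lemma tens_povm b d n m (Pi : 'I_n -> 'M[C]_b) (Ga : 'I_m -> 'M[C]_d) :
  povm Pi -> povm Ga ->
  povm (fun y => Pi (mxtens_unindex y).1 *t Ga (mxtens_unindex y).2).
Proof.
move=> [pPi sPi] [pGa sGa]; split=> [y|]; first exact: psdmx_tens.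
rewrite -tensmx11 -sPi -sGa; apply/matrixP => i j.
by rewrite [RHS]mxE !summxE mulr_sum; apply: eq_bigr => k _; rewrite mxE.
Qed.

Lemma tens_density a c (rho : 'M[C]_a) (tau : 'M[C]_c) :
  density rho -> density tau -> density (rho *t tau).
Proof.
move=> [prho trho] [ptau ttau]; split; first exact: psdmx_tens.
by rewrite mxtrace_tens trho ttau mulr1.
Qed.

Lemma score_ge0 a b (N : 'M[C]_a -> 'M[C]_b) n (Pi : 'I_n -> 'M[C]_b) rho :
  psd_on_states N -> povm Pi -> (forall y, density (rho y)) ->
  0 <= score N Pi rho.
Proof.
move=> N_psd [pPi _] drho; apply: sumr_ge0 => y _.
by apply/Re_ge0/mxtrace_psdM_ge0 => //; exact: N_psd.
Qed.

Variables a b c d : nat.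
Variables (N : {linear 'M[C]_a -> 'M[C]_b}) (M : {linear 'M[C]_c -> 'M[C]_d}).
Hypotheses (N_psd : psd_on_states N) (M_psd : psd_on_states M).

(** Traces factor over the tensor product, and the real part is multiplicative here because both
    traces are nonnegative. *)
Lemma score_tens n m (Pi : 'I_n -> 'M[C]_b) (Ga : 'I_m -> 'M[C]_d) rho tau :
  povm Pi -> povm Ga -> (forall y, density (rho y)) ->
  (forall y, density (tau y)) ->
  score N Pi rho * score M Ga tau =
  score (tensop N M)
    (fun y => Pi (mxtens_unindex y).1 *t Ga (mxtens_unindex y).2)
    (fun y => rho (mxtens_unindex y).1 *t tau (mxtens_unindex y).2).
Proof.
move=> [pPi _] [pGa _] drho dtau; rewrite /score mulr_sum.
apply: eq_bigr => y _; rewrite tensopE tensmx_mul mxtrace_tens ReM_ge0 //.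
  by apply: mxtrace_psdM_ge0 => //; exact: N_psd.
by apply: mxtrace_psdM_ge0 => //; exact: M_psd.
Qed.

Hypotheses (a_gt0 : (0 < a)%N) (b_gt0 : (0 < b)%N).
Hypotheses (c_gt0 : (0 < c)%N) (d_gt0 : (0 < d)%N).

Lemma cv_ge0 Z : dominates N Z -> 0 <= cv N.
Proof.
move=> domN; have [rho drho] := exists_density R a_gt0.
apply: le_trans _ (score_le_cv b_gt0 N_psd domN (@povm1 R b) (fun=> drho)).
by apply: score_ge0 => //; exact: povm1.
Qed.

Lemma cv_tens_ge Z Z' : dominates N Z -> dominates (tensop N M) Z' ->
  psd_on_states (tensop N M) -> cv N * cv M <= cv (tensop N M).
Proof.
move=> domN domNM NM_psd.
have ac_gt0 : (0 < a * c)%N by rewrite muln_gt0 a_gt0.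
have bd_gt0 : (0 < b * d)%N by rewrite muln_gt0 b_gt0.
have score_le n m (Pi : 'I_n -> 'M[C]_b) (Ga : 'I_m -> 'M[C]_d) rho tau :
    povm Pi -> povm Ga -> (forall y, density (rho y)) ->
    (forall y, density (tau y)) ->
    score N Pi rho * score M Ga tau <= cv (tensop N M).
  move=> pPi pGa drho dtau; rewrite score_tens //.
  apply: (score_le_cv bd_gt0 NM_psd domNM); first exact: tens_povm.
  by move=> y; exact: tens_density.
have cv0 : 0 <= cv (tensop N M).
  have [rho drho] := exists_density R a_gt0.
  have [tau dtau] := exists_density R c_gt0.
  apply: le_trans _ (score_le _ _ _ _ _ _ (@povm1 R b) (@povm1 R d)
    (fun=> drho) (fun=> dtau)).
  by apply: mulr_ge0; apply: score_ge0 => //; exact: povm1.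
(* The suprema are taken one factor at a time, dividing by the other; zero factors are treated
   apart. *)
have := cv_ge0 domN; rewrite le_eqVlt => /predU1P[<-|cvN];
  first by rewrite mul0r.
rewrite mulrC -ler_pdivlMr //; apply: cv_le => // m Ga tau pGa dtau.
rewrite ler_pdivlMr //.
have := score_ge0 M_psd pGa dtau.
rewrite le_eqVlt => /predU1P[<-|sM]; first by rewrite mul0r.
rewrite mulrC -ler_pdivlMr //; apply: cv_le => // n Pi rho pPi drho.
by rewrite ler_pdivlMr //; exact: score_le.
Qed.

End ProductStrategies.

(** * Tensor powers of the channel and the capacity *)

Section TensorPowers.
Variable R : realType.
Local Notation C := R[i].

Lemma tensopX_rec_is_linear a b (N : {linear 'M[C]_a -> 'M[C]_b}) k :
  linear (tensopX_rec N k).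
Proof. by case: k => [|k]; [exact: linearP | exact: tensop_is_linear]. Qed.

HB.instance Definition _ a b (N : {linear 'M[C]_a -> 'M[C]_b}) k :=
  GRing.isLinear.Build C 'M[C]_(a ^ k.+1) 'M[C]_(b ^ k.+1) _ (tensopX_rec N k)
    (@tensopX_rec_is_linear a b N k).

Lemma dominates_psd a b (N : 'M[C]_a -> 'M[C]_b) Z : (0 < a)%N ->
  psd_on_states N -> dominates N Z -> psdmx Z.
Proof.
move=> a_gt0 N_psd domN; have [rho drho] := exists_density R a_gt0.
by rewrite -[Z](subrK (N rho)); apply: psdmxD; [exact: domN | exact: N_psd].
Qed.

(** Complete positivity is used with a one-dimensional ancilla, which a submatrix then removes. *)
Lemma channel_psd a b (N : {linear 'M[C]_a -> 'M[C]_b}) :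
  completely_positive N -> psd_on_states N.
Proof.
move=> CP rho [prho _].
have := CP 1 (rho *t 1%:M) (psdmx_tens prho (@psdmx1 R 1)).
rewrite (tensopE N idfun) /= => /(psdmx_mxsub (fun i => mxtens_index (i, 0))).
congr psdmx; apply/matrixP => i j.
by rewrite mxE tensmxE [1%:M _ _]mxE eqxx mulr1.
Qed.

Variables (a b : nat) (N : {linear 'M[C]_a -> 'M[C]_b}).
Hypotheses (a_gt0 : (0 < a)%N) (b_gt0 : (0 < b)%N).
Hypotheses (hN : quantum_channel N) (hEB : entanglement_breaking N).

(** Outputs are states, hence below the identity. This bounds the scores before a better dominating
    operator is available. *)
Lemma channel_dominated1 : dominates N 1%:M.
Proof.
move=> rho drho; apply: density_le1; split.
  exact: channel_psd hN.1 _ drho.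
by rewrite hN.2 drho.2.
Qed.

Lemma cv_ge1 : 1 <= cv N.
Proof.
have [rho drho] := exists_density R a_gt0.
apply: le_trans _ (score_le_cv b_gt0 (channel_psd hN.1) channel_dominated1
  (@povm1 R b) (fun=> drho)).
by rewrite /score big_ord1 mul1mx hN.2 drho.2.
Qed.

(** The induction carries a dominating operator, not just a bound on [cv], since operators are what
    tensor together. Duality is applied to [N] alone. Index [k] stands for [k.+1] tensor factors. *)
Lemma cv_tensopX_rec k :
  [/\ psd_on_states (tensopX_rec N k),
      exists Z, dominates (tensopX_rec N k) Z /\
        complex.Re (\tr Z) <= cv N ^+ k.+1
    & cv N ^+ k.+1 <= cv (tensopX_rec N k)].
Proof.
have N_psd := channel_psd hN.1.
have [Z [domZ trZ]] : exists Z, dominates N Z /\ complex.Re (\tr Z) <= cv N.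
  apply: exists_dominating => // n Pi rho.
  exact: score_le_cv channel_dominated1.
have pZ := dominates_psd a_gt0 N_psd domZ.
elim: k => [|k [M_psd [Z' [domZ' trZ']] cvM]].
  by split=> //; exists Z; rewrite expr1.
have ak_gt0 : (0 < a ^ k.+1)%N by rewrite expn_gt0 a_gt0.
have bk_gt0 : (0 < b ^ k.+1)%N by rewrite expn_gt0 b_gt0.
have pZ' := dominates_psd ak_gt0 M_psd domZ'.
have NM_psd : psd_on_states (tensop N (tensopX_rec N k)).
  by move=> rho [prho _]; exact: EB_tensop_psd.
have domZZ' : dominates (tensop N (tensopX_rec N k)) (Z *t Z').
  exact: tensop_dominated.
split; first exact: NM_psd.
  exists (Z *t Z'); split; first exact: domZZ'.
  rewrite exprS mxtrace_tens ReM_ge0 ?mxtrace_psd_ge0 //.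
  by apply: ler_pM => //; apply: Re_ge0; exact: mxtrace_psd_ge0.
rewrite exprS; apply: (@le_trans _ _ (cv N * cv (tensopX_rec N k))).
  by apply: ler_wpM2l => //; exact: (le_trans ler01 cv_ge1).
exact: cv_tens_ge domZ domZZ' NM_psd.
Qed.

Lemma cv_tensopX k : (0 < k)%N -> cv (tensopX N k) = cv N ^+ k.
Proof.
case: k => // k _; apply/eqP; rewrite eq_le.
have [M_psd [Z [domZ trZ]] cvM] := cv_tensopX_rec k; rewrite cvM andbT.
apply: le_trans trZ; apply: cv_le => //; first by rewrite expn_gt0 a_gt0.
by move=> n Pi rho; exact: score_le_dominated.
Qed.

End TensorPowers.

Theorem corollary3 (R : realType) (a b : nat) (ha : (0 < a)%N) (hb : (0 < b)%N)
    (N : {linear 'M[R[i]]_a -> 'M[R[i]]_b})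
    (hN : quantum_channel N) (hEB : entanglement_breaking N) :
  cvgn (cv_rate N) /\ cv_capacity N = log2 (cv N).
Proof.
have rate_cst : cv_rate N @ \oo --> log2 (cv N).
  (* The rate is constant only from [k = 1] on; at 0 the convention for the inverse of 0 makes it
     0. *)
  apply: cvg_near_cst; exists 1 => // k /= k_gt0.
  rewrite /cv_rate cv_tensopX //.
  have cv_gt0 : 0 < cv N by apply: lt_le_trans ltr01 (cv_ge1 ha hb hN).
  rewrite /log2 lnXn // -[ln _ *+ k]mulr_natl !mulrA mulVf ?mul1r //.
  by rewrite pnatr_eq0 -lt0n.
split; first by apply/cvg_ex; exists (log2 (cv N)).
exact: cvg_lim rate_cst.
Qed.
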